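(* Let $A$ be a complex antidiagonal matrix of size $n$, with center element $c$ if $n$ is odd. Let $\mathcal T$ be the set of nondefective transpose pairs on the antidiagonal of $A$ and $\mathcal T^\complement$ the set of defective ones. For a transpose pair $t$ with elements $\tau_1,\tau_2$, let $\lambda_t$ be any of the eigenvalues associated with $t$ (that is, $\lambda_t=\sqrt{\tau_1}\sqrt{\tau_2}$ or $\lambda_t=-\sqrt{\tau_1}\sqrt{\tau_2}$). (a) The Jordan canonical form of $A$, up to a permutation of Jordan blocks, is the quasidiagonal matrix $J$ that is the direct sum of one block $\begin{pmatrix}0&1\\0&0\end{pmatrix}$ for each defective transpose pair and of the diagonal matrix $$\mathrm{diag}(\lambda_{t_1},\lambda_{t_2},\dots,-\lambda_{t_2},-\lambda_{t_1}),$$ where $t_i\in\mathcal T$ and, for odd $n$, $\lambda_{t_{|\mathcal T|}}=c$ (the pair $t_{|\mathcal T|}$ being that of the center element, with $c$ appearing exactly once, in the middle of the diagonal matrix). If $A$ is written in standard form with entries $a_1,\dots,a_n$, a generalized modal matrix giving a canonical basis is the matrix $\Lambda_G$ defined in the context, for any choice of $x\in\mathbb C\setminus\{0\}$ and $y\in\mathbb C$. (b) $A$ is similar to $\mathfrak N\oplus\mathfrak D$, where the nilpotent part is $$\mathfrak N=\bigoplus_{t\in\mathcal T^\complement}\begin{pmatrix}0&1\\0&0\end{pmatrix}$$ and the diagonal part is $$\mathfrak D=\bigoplus_{t\in\mathcal T}\lambda_t\begin{pmatrix}1&0\\0&-1\end{pmatrix}\ (n\text{ even}),\qquad \mathfrak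 D=\bigoplus_{t\in\mathcal T\setminus\{c,c\}}\lambda_t\begin{pmatrix}1&0\\0&-1\end{pmatrix}\oplus c\,(1)\ (n\text{ odd}),$$ where $(1)$ is the identity matrix of size $1$ and $\mathcal T\setminus\{c,c\}$ omits the pair consisting of the center element.
   Context: An antidiagonal matrix is a square matrix whose only nonzero entries are at positions $(i,n+1-i)$. A transpose pair is a pair of indexed entries that are reflections of each other across the main diagonal (the center element of an odd-size antidiagonal matrix is paired with itself); it is defective if exactly one of the two entries is zero, nondefective otherwise. Quasidiagonal: block diagonal with square diagonal blocks of size at most $2$. $\sqrt{\cdot}$ is a complex square root. Standard form: for $n=2m$, $A_{m+1-j,\,m+j}=a_{2j-1}$, $A_{m+j,\,m+1-j}=a_{2j}$ ($1\le j\le m$); for $n=2m+1$, $A_{m+1,m+1}=a_1$, $A_{m+1-j,\,m+1+j}=a_{2j+1}$, $A_{m+1+j,\,m+1-j}=a_{2j}$ ($1\le j\le m$). Definition of $\Lambda_G$. For each $j$ with $1\le j\le m$, write $a_o$ for the odd-indexed and $a_e$ for the even-indexed element of the $j$-th transpose pair, i.e. $(a_o,a_e)=(a_{2j-1},a_{2j})$ if $n=2m$ and $(a_o,a_e)=(a_{2j+1},a_{2j})$ if $n=2m+1$. For $n=2m$, columns $2j-1,2j$ of $\Lambda_G$ are zero outside rows $m+1-j$ (upper) and $m+j$ (lower). For $n=2m+1$, column $1$ has a single nonzero entry $\omega$ in row $m+1$ (any nonzero $\omega\in\mathbb C$), and columns $2j,2j+1$ are zero outside rows $m+1-j$ (upper)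 and $m+1+j$ (lower). The ordered pair of these two columns, restricted to the (upper, lower) rows, is $\big((-\tfrac{\sqrt{a_o}}{\sqrt{a_e}},1),(\tfrac{\sqrt{a_o}}{\sqrt{a_e}},1)\big)$, except that: if $a_o=a_e=0$, it is replaced by any chosen pair of linearly independent vectors of $\mathbb C^2$; and if the pair $a_o,a_e$ is defective with nonzero element $\tau$, it is replaced by the ordered pair $\big((x,0),(y,\tfrac{x}{\tau})\big)$ for any choice of $x\in\mathbb C\setminus\{0\}$ and $y\in\mathbb C$.
   Formalization: For a defective pair with a_o = 0 and a_e = τ, the pair ((x,0),(y,x/τ)) in (upper, lower) rows is not a Jordan chain (e.g. n=2, a_1=0, a_2=1); there Λ_G is taken with ((0,x),(x/τ,y)) instead. *)

(* Defs.v *)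
(* The complex numbers are R[i] for R : realType. *)
From mathcomp Require Import all_boot all_order all_algebra.
From mathcomp Require Export complex reals.
Set Implicit Arguments.
Unset Strict Implicit.
Unset Printing Implicit Defensive.
Import GRing.Theory.
Local Open Scope ring_scope.

Definition antidiagonal (F : fieldType) n (A : 'M[F]_n) : Prop :=
  forall i j : 'I_n, j != rev_ord i -> A i j = 0.

(* A transpose pair {(i, rev_ord i), (rev_ord i, i)} is represented by the
   smaller of its two row indices. *)
Definition transpose_pairs n : {set 'I_n} := [set i : 'I_n | (i <= rev_ord i)%N].

Definition center_pairs n : {set 'I_n} := [set i : 'I_n | rev_ord i == i].

Definition defective (F : fieldType) n (A : 'M[F]_n) (i : 'I_n) : bool :=
  (A i (rev_ord i) == 0) (+) (A (rev_ord i) i == 0).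

Definition nondefective_pairs (F : fieldType) n (A : 'M[F]_n) : {set 'I_n} :=
  [set i in transpose_pairs n | ~~ defective A i].

Definition defective_pairs (F : fieldType) n (A : 'M[F]_n) : {set 'I_n} :=
  [set i in transpose_pairs n | defective A i].

(* The dimensions of A and B are only provably equal when B is a direct sum,
   hence the cast. *)
Definition similar_mx (F : fieldType) m n (A : 'M[F]_n) (B : 'M[F]_m) : Prop :=
  exists e : m = n, A ~_{in unitmx} castmx (e, e) B.

Definition jordan_block (F : fieldType) (l : F) k : 'M[F]_k :=
  \matrix_(i < k, j < k) if i == j then l else (i.+1 == j :> nat)%:R.

(* A Jordan matrix is given by the list of its blocks (eigenvalue, size). *)
Definition jordan_dim (F : fieldType) (bs : seq (F * nat)) : nat :=
  (\sum_(i < size bs) (nth (0%R, 0) bs i).2)%N.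

Definition jordan_mx (F : fieldType) (bs : seq (F * nat)) :
    'M[F]_(jordan_dim bs) :=
  \mxdiag_(i < size bs)
    jordan_block (nth (0, 0%N) bs i).1 (nth (0, 0%N) bs i).2.

Definition jordan_form (F : fieldType) n (A : 'M[F]_n) (bs : seq (F * nat)) :
    Prop :=
  all (fun b => 0 < b.2)%N bs /\ similar_mx A (jordan_mx bs).

(* The columns of M form a canonical basis: taken in order they are
   consecutive Jordan chains of A, one for each block of bs. *)
Definition generalized_modal (F : fieldType) n (A M : 'M[F]_n)
    (bs : seq (F * nat)) : Prop :=
  [/\ all (fun b => 0 < b.2)%N bs, M \in unitmx &
      exists e : jordan_dim bs = n,
        A *m M = M *m castmx (e, e) (jordan_mx bs)].

Definition quasidiagonal_blocks (F : fieldType) (d : nat) (mus : seq F) :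
    seq (F * nat) :=
  nseq d (0, 2%N) ++ [seq (mu, 1%N) | mu <- mus].

Definition nilp2 (F : fieldType) : 'M[F]_2 := delta_mx 0 1.

Definition sgn2 (F : fieldType) : 'M[F]_2 := diag_mx (\row_(j < 2) (-1) ^+ j).

(* In what follows m = n./2, row and column numbers are counted from 1 (hence
   the successors applied to ordinals), and u, l are the rows m+1-j and
   m+j (n even) or m+1+j (n odd) of the j-th transpose pair. *)
Definition pair_rows n (j : nat) (u l : 'I_n) : Prop :=
  [/\ (1 <= j <= n./2)%N,
      u.+1 = (n./2.+1 - j)%N &
      l.+1 = (if odd n then n./2.+1 + j else n./2 + j)%N].

Definition odd_index n (j : nat) : nat :=
  if odd n then (2 * j).+1 else (2 * j).-1.

Definition even_index (j : nat) : nat := (2 * j)%N.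

Definition standard_form (F : fieldType) n (A : 'M[F]_n) (a : nat -> F) : Prop :=
  (forall i : 'I_n, odd n -> i.+1 = n./2.+1 -> A i i = a 1%N) /\
  (forall (j : nat) (u l : 'I_n), pair_rows j u l ->
     A u l = a (odd_index n j) /\ A l u = a (even_index j)).

Definition vec2 (F : fieldType) (x y : F) : 'cV[F]_2 :=
  \col_(k < 2) (if k == 0 then x else y).

(* Coordinates are in (upper, lower) order.  For a defective pair (x, 0) and
   (y, x / tau) are the coordinates in (row containing tau, other row), so
   that (v1, v2) is a Jordan chain in both cases. *)
Definition modal_pair (F : fieldType) (sq : F -> F) (ao ae : F)
    (v1 v2 : 'cV[F]_2) : Prop :=
  match ao == 0, ae == 0 with
  | false, false =>
      v1 = vec2 (- (sq ao / sq ae)) 1 /\ v2 = vec2 (sq ao / sq ae) 1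
  | true, true => free [:: v1; v2]
  | false, true =>
      exists x y : F, [/\ x != 0, v1 = vec2 x 0 & v2 = vec2 y (x / ao)]
  | true, false =>
      exists x y : F, [/\ x != 0, v1 = vec2 0 x & v2 = vec2 (x / ae) y]
  end.

(* L is one of the admissible values of Lambda_G; the free parameters are
   chosen independently for each transpose pair. *)
Definition is_LambdaG (F : fieldType) n (sq : F -> F) (a : nat -> F)
    (L : 'M[F]_n) : Prop :=
  (odd n -> exists2 w : F, w != 0 &
     forall i k : 'I_n, k.+1 = 1%N ->
       L i k = if i.+1 == n./2.+1 then w else 0) /\
  (forall (j : nat) (u l k1 k2 : 'I_n), pair_rows j u l ->
     k1.+1 = (if odd n then 2 * j else (2 * j).-1)%N -> k2.+1 = k1.+2 ->
     (forall i : 'I_n, i != u -> i != l -> L i k1 = 0 /\ L i k2 = 0) /\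
     modal_pair sq (a (odd_index n j)) (a (even_index j))
       (vec2 (L u k1) (L l k1)) (vec2 (L u k2) (L l k2))).

(* Main.v *)
(* An antidiagonal matrix couples only the rows of a transpose pair, so the two
   columns of Lambda_G attached to a pair are Jordan chains of the 2x2 matrix
   (x, y) |-> (ao y, ae x): one chain of length 2 if the pair is defective, two
   eigenvectors for -+ sqrt ao sqrt ae otherwise.  The two columns are independent
   and the pairs have disjoint supports, so Lambda_G is invertible and its columns
   form a canonical basis.  The Jordan form is unique because the number of blocks
   (l, k + 1) is the second difference of the ranks of (A - l)^k, (A - l)^(k+1),
   (A - l)^(k+2). *)
Require Import Defs.
From mathcomp Require Import all_boot all_order all_algebra.
From mathcomp Require Import complex reals zify ring.
Import GRing.Theory.
Local Open Scope ring_scope.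

Set Implicit Arguments.
Unset Strict Implicit.

(** * Similarity of block diagonal matrices *)

(* Allowing [m <> n] in the types of P and Q avoids the cast of [similar_mx]. *)
Lemma similarP (F : fieldType) m n (A : 'M[F]_n) (B : 'M[F]_m) :
  similar_mx A B <->
  exists (P : 'M_(m, n)) (Q : 'M_(n, m)),
    [/\ P *m Q = 1%:M, Q *m P = 1%:M & P *m A = B *m P].
Proof.
split=> [[e [P Pu]]|[P [Q [PQ QP PA]]]].
  case: n / e in A P Pu *; rewrite castmx_id => /(simmxP Pu) PA.
  by exists P, (invmx P); rewrite mulmxV ?mulVmx.
(* The identities [P *m Q] and [Q *m P] have ranks [m] and [n], bounded by the inner dimensions [n]
   and [m]. *)
have e : m = n.
  apply/eqP; rewrite eqn_leq -{1}(mxrank1 F m) -{2}(mxrank1 F n) -PQ -QP.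
  by rewrite !(leq_trans (mxrankM_maxl _ _)) ?rank_leq_col.
exists e; case: n / e in A P Q PQ QP PA *; have [Pu _] := mulmx1_unit PQ.
by exists P => //; apply/(simmxP Pu); rewrite castmx_id.
Qed.

Lemma similar_refl (F : fieldType) n (A : 'M[F]_n) : similar_mx A A.
Proof.
by apply/similarP; exists 1%:M, 1%:M; split; rewrite ?mulmx1 ?mul1mx.
Qed.

Lemma similar_sym (F : fieldType) m n (A : 'M[F]_n) (B : 'M[F]_m) :
  similar_mx A B -> similar_mx B A.
Proof.
move=> /similarP[P [Q [PQ QP PA]]]; apply/similarP; exists Q, P; split=> //.
by rewrite -[LHS]mulmx1 -PQ mulmxA -[Q *m B *m P]mulmxA -PA !mulmxA QP mul1mx.
Qed.

Lemma similar_trans (F : fieldType) m n p (A : 'M[F]_n) (B : 'M[F]_m)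
    (C : 'M[F]_p) : similar_mx A B -> similar_mx B C -> similar_mx A C.
Proof.
move=> /similarP[P [Q [PQ QP PA]]] /similarP[P' [Q' [PQ' QP' PB]]].
apply/similarP; exists (P' *m P), (Q *m Q'); split.
- by rewrite mulmxA -(mulmxA P') PQ mulmx1.
- by rewrite mulmxA -(mulmxA Q) QP' mulmx1.
- by rewrite -mulmxA PA mulmxA PB mulmxA.
Qed.

Lemma similar_block (F : fieldType) m n p q (A : 'M[F]_n) (B : 'M[F]_m)
    (C : 'M[F]_p) (D : 'M[F]_q) :
  similar_mx A B -> similar_mx C D ->
  similar_mx (block_mx A 0 0 C) (block_mx B 0 0 D).
Proof.
move=> /similarP[P [Q [PQ QP PA]]] /similarP[P' [Q' [PQ' QP' PB]]].
apply/similarP; exists (block_mx P 0 0 P'), (block_mx Q 0 0 Q').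
rewrite !mulmx_block !(mulmx0, mul0mx, addr0, add0r).
by rewrite PQ PQ' QP QP' PA PB -!scalar_mx_block.
Qed.

Lemma similar_blockC (F : fieldType) m n (A : 'M[F]_n) (B : 'M[F]_m) :
  similar_mx (block_mx A 0 0 B) (block_mx B 0 0 A).
Proof.
apply/similarP; exists (block_mx 0 1%:M 1%:M 0), (block_mx 0 1%:M 1%:M 0).
rewrite !mulmx_block !(mulmx0, mul0mx, addr0, add0r, mulmx1, mul1mx).
by rewrite -!scalar_mx_block.
Qed.

Lemma similar_block0 (F : fieldType) n (A : 'M[F]_n) (B : 'M[F]_0) :
  similar_mx (block_mx B 0 0 A) A.
Proof.
apply/similarP; exists (row_mx 0 1%:M), (col_mx 0 1%:M); split.
- by rewrite mul_row_col mul0mx mulmx1 add0r.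
- rewrite mul_col_row !(mul0mx, mulmx0, mulmx1) [RHS]scalar_mx_block.
  by congr block_mx; apply/matrixP => -[].
- by rewrite mul_row_block mul_mx_row !(mul0mx, mulmx0, mulmx1, mul1mx) !add0r.
Qed.

Lemma similar_cast (F : fieldType) m n (e : m = n) (A : 'M[F]_m) :
  similar_mx (castmx (e, e) A) A.
Proof. case: n / e; rewrite castmx_id; exact: similar_refl. Qed.

Lemma similar_blockA (F : fieldType) m n p (A : 'M[F]_m) (B : 'M[F]_n)
    (C : 'M[F]_p) :
  similar_mx (block_mx A 0 0 (block_mx B 0 0 C))
             (block_mx (block_mx A 0 0 B) 0 0 C).
Proof.
rewrite -(row_mx0 F m n p) -(col_mx0 F n p m) block_mxA row_mx0 col_mx0.
exact: similar_cast.
Qed.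

Lemma similar_mxdiag_recl (F : fieldType) m (p_ : 'I_m.+1 -> nat)
    (B : forall i, 'M[F]_(p_ i)) :
  similar_mx (\mxdiag_i B i)
    (block_mx (B ord0) 0 0 (\mxdiag_i B (lift ord0 i))).
Proof. rewrite mxdiag_recl; exact: similar_cast. Qed.

Lemma similar_mxdiag0 (F : fieldType) m (p_ : 'I_0 -> nat)
    (B : forall i, 'M[F]_(p_ i)) (C : 'M[F]_m) :
  similar_mx (block_mx (\mxdiag_i B i) 0 0 C) C.
Proof.
move: (\mxdiag_i B i); rewrite big_ord0; exact: similar_block0.
Qed.

Lemma jordan_mx_cons (F : fieldType) (b : F * nat) bs :
  similar_mx (jordan_mx (b :: bs))
    (block_mx (jordan_block b.1 b.2) 0 0 (jordan_mx bs)).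
Proof. exact: (@similar_mxdiag_recl F (size bs)). Qed.

Lemma jordan_mx_cat (F : fieldType) (s t : seq (F * nat)) :
  similar_mx (jordan_mx (s ++ t)) (block_mx (jordan_mx s) 0 0 (jordan_mx t)).
Proof.
elim: s => [|b s IHs]; first exact/similar_sym/similar_mxdiag0.
apply: similar_trans (jordan_mx_cons _ _) _.
apply: similar_trans (similar_block (similar_refl _) IHs) _.
apply: similar_trans (similar_blockA _ _ _) _.
exact/similar_block/similar_refl/similar_sym/jordan_mx_cons.
Qed.

(** Swapping two adjacent segments in front of a common tail is the move from which [catCA_perm_ind]
    generates all permutations. *)
Lemma jordan_mx_catC (F : fieldType) (s t u : seq (F * nat)) :
  similar_mx (jordan_mx ((s ++ t) ++ u)) (jordan_mx ((t ++ s) ++ u)).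
Proof.
apply: similar_trans (jordan_mx_cat _ _) _.
apply: similar_trans _ (similar_sym (jordan_mx_cat _ _)).
apply: similar_block (similar_refl _).
apply: similar_trans (jordan_mx_cat _ _) _.
apply: similar_trans (similar_blockC _ _) _.
exact/similar_sym/jordan_mx_cat.
Qed.

Lemma jordan_mx_perm (F : fieldType) (s t : seq (F * nat)) :
  perm_eq s t -> similar_mx (jordan_mx s) (jordan_mx t).
Proof.
move=> st; pose P u := similar_mx (jordan_mx s) (jordan_mx u).
suff: P t by []; apply: (catCA_perm_ind _ st (similar_refl _)) => s1 s2 s3.
by rewrite /P !catA => /similar_trans; apply; apply: jordan_mx_catC.
Qed.

(** * Uniqueness of the Jordan form *)

(** A conjugation of [A] into [B] also conjugates the powers of [A - l] into those of [B - l]. These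
    ranks are the invariants from which the blocks are recovered. *)
Lemma similar_rank_exp (F : fieldType) m n (A : 'M[F]_n) (B : 'M[F]_m) l k :
  similar_mx A B ->
  \rank ((A - l%:M) ^+ k) = \rank ((B - l%:M) ^+ k).
Proof.
move=> [e [P Pu]]; case: n / e in A P Pu *.
rewrite castmx_id => /(simmxP Pu) PA.
have PX : P *m (A - l%:M) ^+ k = (B - l%:M) ^+ k *m P.
  elim: k => [|k IHk]; first by rewrite !expr0 mulmx1 mul1mx.
  rewrite !exprS -!mulmxE mulmxA mulmxBr PA mul_mx_scalar -mul_scalar_mx.
  by rewrite -mulmxBl -!mulmxA IHk.
have Pf : row_free P by rewrite row_free_unit.
by rewrite -[RHS](mxrankMfree _ Pf) -PX eqmxMfull // row_full_unit.
Qed.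

Lemma rank_exp_block (F : fieldType) m n (A : 'M[F]_n) (B : 'M[F]_m) l k :
  \rank ((block_mx A 0 0 B - l%:M) ^+ k) =
  (\rank ((A - l%:M) ^+ k) + \rank ((B - l%:M) ^+ k))%N.
Proof.
rewrite -rank_diag_block_mx; congr mxrank.
have -> : block_mx A 0 0 B - l%:M = block_mx (A - l%:M) 0 0 (B - l%:M).
  by rewrite [l%:M in LHS]scalar_mx_block opp_block_mx add_block_mx !subr0.
elim: k => [|k IHk]; first by rewrite !expr0 -scalar_mx_block.
by rewrite !exprS IHk -!mulmxE mulmx_block !(mulmx0, mul0mx, addr0, add0r).
Qed.

Lemma jordan_block_subr (F : fieldType) (l l0 : F) s :
  jordan_block l s - l0%:M = jordan_block (l - l0) s.
Proof.
apply/matrixP => i j; rewrite !mxE; case: eqP => _; first by rewrite mulr1n.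
by rewrite mulr0n subr0.
Qed.

Lemma jordan_block_unitmx (F : fieldType) (l : F) s :
  l != 0 -> jordan_block l s \in unitmx.
Proof.
move=> l0; rewrite unitmxE -det_tr det_trig.
  by rewrite unitfE; apply/prodf_neq0 => i _; rewrite !mxE eqxx.
apply/is_trig_mxP => i j ij; rewrite !mxE.
case: eqP => [ji|_]; first by rewrite ji ltnn in ij.
by case: eqP => // ji; rewrite -ji ltnNge leqnSn in ij.
Qed.

Lemma jordan_block0_exp (F : fieldType) s k :
  jordan_block (0 : F) s ^+ k = \matrix_(i < s, j < s) (i + k == j :> nat)%N%:R.
Proof.
elim: k => [|k IHk].
  by apply/matrixP => i j; rewrite expr0 !mxE addn0.
rewrite exprS IHk -mulmxE; apply/matrixP => i j; rewrite !mxE.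
have [is_s|s_i] := ltnP i.+1 s.
  rewrite (bigD1 (Ordinal is_s)) //= big1 ?addr0 => [|i' i'i]; rewrite !mxE /=.
    by rewrite eqxx -val_eqE /= (ltn_eqF (leqnn _)) mul1r addnS.
  case: eqP => _; first by rewrite mul0r.
  by case: eqP => [e|_]; rewrite ?mul0r //; case/eqP: i'i; apply/val_inj.
rewrite big1 => [|i' _]; last first.
  rewrite !mxE; case: eqP => _; first by rewrite mul0r.
  by case: eqP => [e|_]; rewrite ?mul0r //; have := ltn_ord i'; lia.
by case: eqP => // e; have := ltn_ord j; lia.
Qed.

(** For [l != l0] the power is invertible. Otherwise it is the shift by [k], which has [s - k]
    nonzero rows; truncated subtraction covers [k > s]. *)
Lemma rank_jordan_block_exp (F : fieldType) (l l0 : F) s k :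
  \rank ((jordan_block l s - l0%:M) ^+ k) = (s - (l == l0) * k)%N.
Proof.
rewrite jordan_block_subr; have [->|ll0] := eqVneq l l0; last first.
  rewrite mul0n subn0 mxrank_unit //.
  elim: k => [|k IHk]; first by rewrite expr0 unitmx1.
  by rewrite exprS -mulmxE unitmx_mul jordan_block_unitmx ?subr_eq0.
rewrite subrr jordan_block0_exp mul1n.
(* The shift by [k] factors as [X *m Y] through dimension [s - k], where [X] is left invertible and
   [Y] right invertible. *)
pose X : 'M[F]_(s, s - k) := \matrix_(i, j) (i == j :> nat)%:R.
pose Y : 'M[F]_(s - k, s) := \matrix_(i, j) (i + k == j :> nat)%N%:R.
have XX : X^T *m X = 1%:M.
  apply/matrixP => i j; rewrite !mxE.
  have i_s : (i < s)%N by have := ltn_ord i; lia.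
  rewrite (bigD1 (Ordinal i_s)) //= big1 ?addr0 => [|i' i'i]; rewrite !mxE /=.
    by rewrite eqxx mul1r.
  by case: eqP => [e|_]; rewrite ?mul0r //; case/eqP: i'i; apply/val_inj.
have YY : Y *m Y^T = 1%:M.
  apply/matrixP => i j; rewrite !mxE.
  have i_s : (i + k < s)%N by have := ltn_ord i; lia.
  rewrite (bigD1 (Ordinal i_s)) //= big1 ?addr0 => [|i' i'i]; rewrite !mxE /=.
    by rewrite eqxx mul1r eqn_add2r eq_sym.
  by case: eqP => [e|_]; rewrite ?mul0r //; case/eqP: i'i; apply/val_inj.
have -> : (\matrix_(i < s, j < s) (i + k == j :> nat)%N%:R : 'M[F]_s) = X *m Y.
  apply/matrixP => i j; rewrite !mxE.
  have [i_s|s_i] := ltnP i (s - k).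
    rewrite (bigD1 (Ordinal i_s)) //= big1 ?addr0 => [|i' i'i]; rewrite !mxE /=.
      by rewrite eqxx mul1r.
    by case: eqP => [e|_]; rewrite ?mul0r //; case/eqP: i'i; apply/val_inj.
  rewrite big1 => [|i' _]; last first.
    rewrite !mxE; case: eqP => [e|_]; rewrite ?mul0r //.
    by have := ltn_ord i'; lia.
  by case: eqP => // e; have := ltn_ord j; lia.
apply/eqP; rewrite eqn_leq (leq_trans (mxrankM_maxl _ _) (rank_leq_col _)).
(* For the lower bound, the identity of size [s - k] is [X^T *m (X *m Y) *m Y^T]. *)
rewrite -{1}(mxrank1 F (s - k)) -[1%:M]mulmx1 -{1}XX -YY.
rewrite -mulmxA (mulmxA X) (leq_trans (mxrankM_maxr _ _)) //.
exact: mxrankM_maxl.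
Qed.

Lemma rank_jordan_mx_exp (F : fieldType) (l : F) bs k :
  \rank ((jordan_mx bs - l%:M) ^+ k) =
  (\sum_(b <- bs) (b.2 - (b.1 == l) * k))%N.
Proof.
elim: bs => [|b bs IHbs].
  apply/eqP; rewrite big_nil -leqn0 (leq_trans (rank_leq_row _)) //.
  by rewrite /jordan_dim big_ord0.
by rewrite (similar_rank_exp _ _ (jordan_mx_cons _ _)) rank_exp_block IHbs
  rank_jordan_block_exp big_cons.
Qed.

(* [r k] is the rank of [(jordan_mx bs - l) ^+ k]. *)
Lemma count_jordan_blocks (F : fieldType) (l : F) (bs : seq (F * nat)) k :
  let r k := (\sum_(b <- bs) (b.2 - (b.1 == l) * k))%N in
  (r k + r k.+2 = r k.+1 + r k.+1 + count_mem (l, k.+1) bs)%N.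
Proof.
elim: bs => [|[l' s] bs] /=; first by rewrite !big_nil.
by rewrite !big_cons xpair_eqE /=; case: (l' == l) => /=; lia.
Qed.

Lemma jordan_mx_uniq (F : fieldType) (s t : seq (F * nat)) :
  all (fun b => 0 < b.2)%N s -> all (fun b => 0 < b.2)%N t ->
  similar_mx (jordan_mx s) (jordan_mx t) -> perm_eq s t.
Proof.
move=> s0 t0 st; apply/allP => -[l [|k]] _ /=; apply/eqP.
  (* Blocks of size 0 are invisible in the matrix; only the positivity assumption excludes them. *)
  have count0 u : all (fun b : F * nat => 0 < b.2)%N u ->
      count_mem (l, 0%N) u = 0%N.
    by move=> u0; apply/count_memPn/negP => /(allP u0).
  by rewrite !count0.
have E p : (\sum_(b <- s) (b.2 - (b.1 == l) * p) =
            \sum_(b <- t) (b.2 - (b.1 == l) * p))%N.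
  by rewrite -!rank_jordan_mx_exp; apply: similar_rank_exp.
have := count_jordan_blocks l s k; rewrite /= !E count_jordan_blocks.
by move/addnI.
Qed.

(** * Jordan forms of the nilpotent and diagonal summands *)

Lemma similar_dim0 (F : fieldType) m n (A : 'M[F]_n) (B : 'M[F]_m) :
  n = 0%N -> m = 0%N -> similar_mx A B.
Proof.
move=> n0 m0; rewrite n0 in A *; rewrite m0 in B *.
by rewrite (flatmx0 A) (flatmx0 B); apply: similar_refl.
Qed.

Lemma jordan_mx1 (F : fieldType) (b : F * nat) :
  similar_mx (jordan_mx [:: b]) (jordan_block b.1 b.2).
Proof.
apply: similar_trans (jordan_mx_cons _ _) _.
apply: similar_trans (similar_blockC _ _) _; exact: similar_mxdiag0.
Qed.

Lemma similar_nilp2_sum (F : fieldType) d :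
  similar_mx (\mxdiag_(k < d) nilp2 F) (jordan_mx (nseq d (0, 2%N))).
Proof.
elim: d => [|d IHd]; first by apply: similar_dim0; rewrite /jordan_dim big_ord0.
apply: similar_trans (similar_mxdiag_recl _) _.
apply: similar_trans _ (similar_sym (jordan_mx_cons _ _)).
have <- : nilp2 F = jordan_block 0 2.
  apply/matrixP => i j; rewrite !mxE.
  by case: i j => [[|[|]]] // ? [[|[|]]].
exact: similar_block (similar_refl _) IHd.
Qed.

Lemma similar_sgn2_sum (F : fieldType) (T : Type) (f : T -> F) (ts : seq T) :
  similar_mx (\mxdiag_(k < size ts) ([seq f t | t <- ts]`_k *: sgn2 F))
    (jordan_mx (flatten [seq [:: (f t, 1%N); (- f t, 1%N)] | t <- ts])).
Proof.
elim: ts => [|t ts IHts].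
  by apply: similar_dim0; rewrite /jordan_dim big_ord0.
apply: similar_trans (similar_mxdiag_recl _) _.
apply: similar_trans _ (similar_sym (jordan_mx_cat [:: _; _] _)).
apply: similar_block IHts.
apply: similar_trans _ (similar_sym (jordan_mx_cat [:: _] [:: _])).
apply: similar_trans _ (similar_sym (similar_block (jordan_mx1 _) (jordan_mx1 _))).
(* The scaled [sgn2] is diagonal with entries [f t] and [- f t], hence a direct sum of two Jordan
   blocks of size 1. *)
suff -> : [seq f t | t <- t :: ts]`_(@ord0 (size ts)) *: sgn2 F =
   block_mx (jordan_block (f t) 1) 0 0 (jordan_block (- f t) 1).
  exact: similar_refl.
apply/matrixP => i j.
case: (@split_ordP 1 1 i) => i' ->; case: (@split_ordP 1 1 j) => j' ->;
  rewrite !ord1 !mxE /=; case: splitP => k; rewrite (ord1 k) //= => _;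
  rewrite mxE; case: splitP => k'; rewrite (ord1 k') //= => _;
  by rewrite !mxE /= ?mulr1 ?mulrN1 ?mulr0.
Qed.

(** The boolean serves as a dimension: it will be the parity of [n], so that the center summand
    exists exactly for odd [n]. *)
Lemma similar_scalar_bool (F : fieldType) (c : F) (b : bool) :
  similar_mx (c *: (1%:M : 'M[F]_b)) (jordan_mx (nseq b (c, 1%N))).
Proof.
case: b; last by apply: similar_dim0; rewrite /jordan_dim ?big_ord0.
apply: similar_trans _ (similar_sym (jordan_mx1 _)).
suff -> : c *: 1%:M = jordan_block c 1 by exact: similar_refl.
by apply/matrixP => i j; rewrite !ord1 !mxE /= mulr1.
Qed.

(** * Jordan chains *)

(** The vectors come from a sequence indexed by [nat], each block consuming as many as its size, so
    that lists of blocks concatenate without casts. *)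
Fixpoint jordan_chains (F : fieldType) n (A : 'M[F]_n) (f : nat -> 'cV[F]_n)
    (bs : seq (F * nat)) : Prop :=
  if bs is b :: bs' then
    (forall k, (k < b.2)%N ->
       A *m f k = b.1 *: f k + (if k is k'.+1 then f k' else 0)) /\
    jordan_chains A (fun k => f (b.2 + k)%N) bs'
  else True.

Lemma jordan_chains_ext (F : fieldType) n (A : 'M[F]_n) f g bs :
  f =1 g -> jordan_chains A f bs -> jordan_chains A g bs.
Proof.
elim: bs f g => //= b bs IHbs f g fg [Af fbs]; split.
  by case=> [|k] /Af; rewrite -!fg.
by apply: IHbs fbs => k; apply: fg.
Qed.

Lemma jordan_chains_cat (F : fieldType) n (A : 'M[F]_n) f s t :
  jordan_chains A f s ->
  jordan_chains A (fun k => f (\sum_(b <- s) b.2 + k)%N) t ->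
  jordan_chains A f (s ++ t).
Proof.
elim: s f => [|b s IHs] f /=.
  by move=> _; apply: jordan_chains_ext => k; rewrite big_nil.
move=> [Af fs] ft; split=> //; apply: IHs fs _.
by apply: jordan_chains_ext ft => k; rewrite big_cons addnA.
Qed.

Definition cols_mx (F : fieldType) n p (f : nat -> 'cV[F]_n) : 'M[F]_(n, p) :=
  \matrix_(i, k) f k i 0.

Lemma cols_mx_cast (F : fieldType) n p q (A : 'M[F]_n) f (B : 'M[F]_p)
    (e : p = q) :
  A *m cols_mx p f = cols_mx p f *m B ->
  A *m cols_mx q f = cols_mx q f *m castmx (e, e) B.
Proof. by case: q / e; rewrite castmx_id. Qed.

(** Column [k] of a Jordan block has [l] in row [k] and, for [k > 0], a [1] in row [k - 1]; the
    chain equations are the matrix equation read by columns. *)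
Lemma cols_mx_block (F : fieldType) n (A : 'M[F]_n) (f : nat -> 'cV[F]_n) l s :
  (forall k, (k < s)%N ->
     A *m f k = l *: f k + (if k is k'.+1 then f k' else 0)) ->
  A *m cols_mx s f = cols_mx s f *m jordan_block l s.
Proof.
move=> Af; apply/matrixP => i k.
have -> : (A *m cols_mx s f) i k = (A *m f k) i 0.
  by rewrite !mxE; apply: eq_bigr => j _; rewrite !mxE.
rewrite Af // !mxE (bigD1 k) //= !mxE eqxx mulrC; congr (_ + _).
case: k => [[|k] k_s] /=.
  by rewrite mxE big1 // => j jk; rewrite !mxE (negPf jk) /= mulr0.
have k'_s : (k < s)%N by apply: ltnW.
rewrite (bigD1 (Ordinal k'_s)) ?neq_ltn ?ltnSn //= big1 ?addr0.
  by rewrite !mxE /= -val_eqE /= (ltn_eqF (ltnSn k)) eqxx mulr1.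
move=> j /andP[jk jk']; rewrite !mxE (negPf jk).
by case: eqP => [[e]|_]; rewrite ?mulr0 //; case/eqP: jk'; apply/val_inj.
Qed.

Lemma jordan_chains_cols (F : fieldType) n (A : 'M[F]_n) f bs :
  jordan_chains A f bs ->
  A *m cols_mx (jordan_dim bs) f = cols_mx (jordan_dim bs) f *m jordan_mx bs.
Proof.
elim: bs f => [|b bs IHbs] f /=.
  move=> _; move: (jordan_mx _); rewrite /jordan_dim big_ord0 => B.
  by rewrite [LHS]thinmx0 [RHS]thinmx0.
case=> Ab fbs.
rewrite [jordan_mx _](@mxdiag_recl _ (size bs)) -/(jordan_mx bs).
apply: (@cols_mx_cast _ _ (b.2 + jordan_dim bs)).
have -> : cols_mx (b.2 + jordan_dim bs) f =
    row_mx (cols_mx b.2 f) (cols_mx (jordan_dim bs) (fun k => f (b.2 + k)%N)).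
  apply/matrixP => i k; rewrite [RHS]mxE.
  by case: splitP => j jk; rewrite !mxE jk.
rewrite mul_mx_row mul_row_block !mulmx0 addr0 add0r IHbs //.
by rewrite (cols_mx_block Ab).
Qed.

Lemma jordan_chains_modal (F : fieldType) n (A M : 'M[F]_n)
    (f : nat -> 'cV[F]_n) bs :
  (forall k : 'I_n, col k M = f k) -> jordan_chains A f bs ->
  forall e : jordan_dim bs = n,
  A *m M = M *m castmx (e, e) (jordan_mx bs).
Proof.
move=> Mf /jordan_chains_cols Af e.
have -> : M = cols_mx n f by apply/matrixP => i k; rewrite mxE -Mf mxE.
exact: cols_mx_cast.
Qed.

(** * Transpose pairs *)

(** Replaces row numbers counted from 1 by a condition on the upper row alone: with rows counted
    from 0, [j] grows from the middle outwards. *)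
Lemma pair_rowsP n j (u l : 'I_n) :
  pair_rows j u l <-> [/\ (u < rev_ord u)%N, l = rev_ord u & j = (n./2 - u)%N].
Proof.
split=> [[j1 uE lE]|[u_rev -> ->]].
  have le : l = rev_ord u by apply/val_inj => /=; case: ifP lE => ? ?; lia.
  by split=> //=; [case: ifP lE => ? ?; lia | lia].
have := ltn_ord u; rewrite /= in u_rev *.
by split=> /=; [lia | lia | case: ifP => ?; lia].
Qed.

Lemma vec2_inj (F : fieldType) (x y x' y' : F) :
  vec2 x y = vec2 x' y' -> x = x' /\ y = y'.
Proof.
by move/colP => E; have := E 0; have := E 1; rewrite !mxE.
Qed.

(** If the determinant vanishes, the first vector is a multiple of the second, with the coefficient
    read off from a nonzero coordinate of the latter. *)
Lemma free2_det (F : fieldType) (x1 y1 x2 y2 : F) :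
  free [:: vec2 x1 y1; vec2 x2 y2] -> x1 * y2 - y1 * x2 != 0.
Proof.
rewrite free_cons span_seq1 seq1_free => /andP[notin v2_neq0].
apply: contraNN notin => /eqP/subr0_eq det0; apply/vlineP.
have [x20|x20] := eqVneq x2 0; last first.
  exists (x1 / x2); apply/colP => i; rewrite !mxE; case: ifP => _.
    by rewrite divfK.
  by rewrite mulrAC det0 mulfK.
have y20 : y2 != 0.
  apply: contraNN v2_neq0 => /eqP y20; apply/eqP/colP => i.
  by rewrite !mxE x20 y20 if_same.
exists (y1 / y2); apply/colP => i; rewrite !mxE; case: ifP => _.
  by rewrite mulrAC -det0 mulfK.
by rewrite divfK.
Qed.

(** The order of the two eigenvalues is that of the columns of Lambda_G. A pair of zeros falls in
    the second branch, which gives two blocks for 0 as soon as [sq] is a square root. *)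
Definition pair_blocks (F : fieldType) (sq : F -> F) (ao ae : F) :
    seq (F * nat) :=
  if (ao == 0) (+) (ae == 0) then [:: (0, 2%N)]
  else [:: (- (sq ao * sq ae), 1%N); (sq ao * sq ae, 1%N)].

(* [(x, y) |-> (ao y, ae x)] is the action of A on a transpose pair. *)
Lemma modal_pair_chain (F : numFieldType) (sq : F -> F)
    (hsq : forall z, sq z ^+ 2 = z) (ao ae x1 y1 x2 y2 : F) :
  modal_pair sq ao ae (vec2 x1 y1) (vec2 x2 y2) ->
  x1 * y2 - y1 * x2 != 0 /\
  if (ao == 0) (+) (ae == 0)
  then [/\ ao * y1 = 0, ae * x1 = 0, ao * y2 = x1 & ae * x2 = y1]
  else let mu := sq ao * sq ae in
    [/\ ao * y1 = - mu * x1, ae * x1 = - mu * y1,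
        ao * y2 = mu * x2 & ae * x2 = mu * y2].
Proof.
have sq0 : sq 0 = 0 by apply/eqP; rewrite -sqrf_eq0 hsq.
rewrite /modal_pair; case: eqVneq => [->|ao0]; case: eqVneq => [->|ae0] /=.
- move/free2_det => det; split=> //.
  by rewrite sq0 !mul0r oppr0 !mul0r.
- move=> [x [y [x0 /vec2_inj[-> ->] /vec2_inj[-> ->]]]].
  rewrite !mul0r mulr0 sub0r oppr_eq0; split; last by rewrite mulrC divfK.
  by rewrite !mulf_neq0 ?invr_neq0.
- move=> [x [y [x0 /vec2_inj[-> ->] /vec2_inj[-> ->]]]].
  rewrite !mul0r mulr0 subr0; split; last by rewrite mulrC divfK.
  by rewrite !mulf_neq0 ?invr_neq0.
move=> [/vec2_inj[-> ->] /vec2_inj[-> ->]].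
have so0 : sq ao != 0 by rewrite -sqrf_eq0 hsq.
have se0 : sq ae != 0 by rewrite -sqrf_eq0 hsq.
split; last first.
  (* Writing [ao] and [ae] as the squares of their roots turns the four equations into rational
     identities. *)
  move: (sq ao) (sq ae) so0 se0 (hsq ao) (hsq ae) => s e s0 e0 <- <-.
  by split; field.
(* The determinant is [-2 * (sq ao / sq ae)], nonzero because the characteristic is 0. *)
rewrite mulr1 mul1r -opprD oppr_eq0 -mulr2n Num.Theory.mulrn_eq0 //=.
by rewrite mulf_neq0 ?invr_neq0.
Qed.

Definition pair_vec (F : fieldType) n (u : 'I_n) (x y : F) : 'cV[F]_n :=
  \col_i (if i == u then x else if i == rev_ord u then y else 0).

Lemma antidiagonal_mul (F : fieldType) n (A : 'M[F]_n) p (B : 'M[F]_(n, p)) i k :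
  antidiagonal A -> (A *m B) i k = A i (rev_ord i) * B (rev_ord i) k.
Proof.
move=> hA; rewrite mxE (bigD1 (rev_ord i)) //= big1 ?addr0 // => j ji.
by rewrite hA ?mul0r.
Qed.

Lemma antidiagonal_pair_vec (F : fieldType) n (A : 'M[F]_n) (u : 'I_n) x y :
  antidiagonal A -> (u < rev_ord u)%N ->
  A *m pair_vec u x y = pair_vec u (A u (rev_ord u) * y) (A (rev_ord u) u * x).
Proof.
move=> hA u_rev; have nu : (rev_ord u == u) = false by rewrite -val_eqE gtn_eqF.
apply/colP => i; rewrite antidiagonal_mul // !mxE.
have [->|iu] := eqVneq i u; first by rewrite nu eqxx.
have [->|iru] := eqVneq i (rev_ord u); first by rewrite rev_ordK eqxx.
rewrite (inj_eq rev_ord_inj) (negPf iu).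
by rewrite -[u]rev_ordK (inj_eq rev_ord_inj) (negPf iru) mulr0.
Qed.

Lemma scale_pair_vec (F : fieldType) n (u : 'I_n) (a x y : F) :
  a *: pair_vec u x y = pair_vec u (a * x) (a * y).
Proof. by apply/colP => i; rewrite !mxE; do 2?case: ifP => _; rewrite ?mulr0. Qed.

Lemma pair_vec0 (F : fieldType) n (u : 'I_n) : pair_vec u 0 0 = 0 :> 'cV[F]_n.
Proof. by apply/colP => i; rewrite !mxE !if_same. Qed.

Lemma pair_chains (F : numFieldType) (sq : F -> F)
    (hsq : forall z, sq z ^+ 2 = z) n (A : 'M[F]_n) (u : 'I_n) f x1 y1 x2 y2 :
  antidiagonal A -> (u < rev_ord u)%N ->
  modal_pair sq (A u (rev_ord u)) (A (rev_ord u) u) (vec2 x1 y1) (vec2 x2 y2) ->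
  f 0%N = pair_vec u x1 y1 -> f 1%N = pair_vec u x2 y2 ->
  jordan_chains A f (pair_blocks sq (A u (rev_ord u)) (A (rev_ord u) u)).
Proof.
move=> hA u_rev /(modal_pair_chain hsq)[_] + f0 f1; rewrite /pair_blocks.
case: ifP => _ [e1 e2 e3 e4] /=.
  split=> // -[|[|//]] _; rewrite ?f0 ?f1 antidiagonal_pair_vec //.
    by rewrite e1 e2 pair_vec0 scale0r addr0.
  by rewrite e3 e4 scale0r add0r.
split; last split=> //; case=> // _; rewrite ?addn0 ?f0 ?f1.
  by rewrite antidiagonal_pair_vec // scale_pair_vec e1 e2 addr0.
by rewrite antidiagonal_pair_vec // scale_pair_vec e3 e4 addr0.
Qed.

(** * The modal matrix *)

Definition nat_col (F : fieldType) n (L : 'M[F]_n) (k : nat) : 'cV[F]_n :=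
  if insub k is Some k' then col k' L else 0.

Lemma nat_col_ord (F : fieldType) n (L : 'M[F]_n) (k : 'I_n) :
  col k L = nat_col L k.
Proof. by rewrite /nat_col valK. Qed.

(** For odd [n], row m+1 is the only row fixed by the reflection. *)
Lemma LambdaG_center (F : fieldType) n (sq : F -> F) a (L : 'M[F]_n) :
  is_LambdaG sq a L -> odd n -> exists2 w, w != 0 &
    nat_col L 0 = \col_i (if i == rev_ord i then w else 0).
Proof.
move=> [+ _] on => /(_ on)[w w0 Lw]; exists w => //.
have n0 : (0 < n)%N by case: n on {L Lw}.
rewrite -[0%N]/(val (Ordinal n0)) -nat_col_ord; apply/colP => i.
rewrite !mxE Lw //; congr (if _ then _ else _); rewrite -val_eqE /=.
by have := ltn_ord i; lia.
Qed.

(** With columns counted from 0, the [j]-th pair starts at column [2 * j.-1], shifted by one when a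
    center column precedes it. *)
Lemma LambdaG_pair (F : fieldType) n (sq : F -> F) a (L : 'M[F]_n) (u : 'I_n) :
  is_LambdaG sq a L -> (u < rev_ord u)%N ->
  let j := (n./2 - u)%N in let k := (odd n + 2 * j.-1)%N in
  exists x1 y1 x2 y2,
    [/\ nat_col L k = pair_vec u x1 y1, nat_col L k.+1 = pair_vec u x2 y2 &
        modal_pair sq (a (odd_index n j)) (a (even_index j))
          (vec2 x1 y1) (vec2 x2 y2)].
Proof.
move=> [_ LG] u_rev j k.
have k1n : (k < n)%N by rewrite /k /j /=; rewrite /= in u_rev; lia.
have k2n : (k.+1 < n)%N by rewrite /k /j /=; rewrite /= in u_rev; lia.
have pr : pair_rows j u (rev_ord u) by apply/pair_rowsP.
have [||L0 mp] := LG j u (rev_ord u) (Ordinal k1n) (Ordinal k2n) pr => //.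
  by rewrite /= /k; rewrite /= /j in u_rev *; case: ifP => ?; lia.
exists (L u (Ordinal k1n)), (L (rev_ord u) (Ordinal k1n)).
exists (L u (Ordinal k2n)), (L (rev_ord u) (Ordinal k2n)); split=> //.
  rewrite -[k]/(val (Ordinal k1n)) -nat_col_ord; apply/colP => i; rewrite !mxE.
  by case: eqVneq => [->//|iu]; case: eqVneq => [->//|il]; case: (L0 i iu il).
rewrite -[k.+1]/(val (Ordinal k2n)) -nat_col_ord; apply/colP => i; rewrite !mxE.
by case: eqVneq => [->//|iu]; case: eqVneq => [->//|il]; case: (L0 i iu il).
Qed.

Lemma mul_pair_vec (F : fieldType) n (v : 'rV[F]_n) (u : 'I_n) x y :
  (u < rev_ord u)%N ->
  (v *m pair_vec u x y) 0 0 = v 0 u * x + v 0 (rev_ord u) * y.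
Proof.
move=> u_rev; have nu : (rev_ord u == u) = false by rewrite -val_eqE gtn_eqF.
rewrite mxE (bigD1 u) //= (bigD1 (rev_ord u)) ?nu //= !mxE eqxx nu eqxx.
rewrite big1 ?addr0 // => i /andP[/negPf iu /negPf il].
by rewrite !mxE iu il mulr0.
Qed.

(** A row vector annihilated by every column vanishes: the columns of a pair give a 2x2 system with
    nonzero determinant for the two coordinates of that pair, and the center column gives the
    remaining coordinate. *)
Lemma LambdaG_unitmx (F : numFieldType) n (sq : F -> F) a (L : 'M[F]_n) :
  (forall z, sq z ^+ 2 = z) -> is_LambdaG sq a L -> L \in unitmx.
Proof.
move=> hsq LG; rewrite -row_free_unit; apply: inj_row_free => v vL.
have v_col k : v *m nat_col L k = 0.
  rewrite /nat_col; case: insubP => [k' _ _|_]; last exact: mulmx0.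
  by rewrite colE mulmxA vL mul0mx.
have v_pair (u : 'I_n) : (u < rev_ord u)%N -> v 0 u = 0 /\ v 0 (rev_ord u) = 0.
  move=> u_rev; have [x1 [y1 [x2 [y2 [c1 c2 mp]]]]] := LambdaG_pair LG u_rev.
  have [det _] := modal_pair_chain hsq mp.
  move: (v_col (odd n + 2 * (n./2 - u).-1)%N)
        (v_col (odd n + 2 * (n./2 - u).-1).+1%N).
  rewrite c1 c2 => /matrixP/(_ 0 0) + /matrixP/(_ 0 0).
  rewrite !mul_pair_vec // mxE; move: (v 0 u) (v 0 (rev_ord u)) => p q e1 e2.
  (* Cramer's rule: eliminating one unknown leaves the determinant times the other. *)
  split; apply: (mulIf det); rewrite mul0r.
    transitivity ((p * x1 + q * y1) * y2 - (p * x2 + q * y2) * y1); first by ring.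
    by rewrite e1 e2; ring.
  transitivity ((p * x2 + q * y2) * x1 - (p * x1 + q * y1) * x2); first by ring.
  by rewrite e1 e2; ring.
apply/rowP => i; rewrite mxE.
have [/v_pair[]//|ri|ri] := ltngtP i (rev_ord i).
  by have [|_] := v_pair (rev_ord i); rewrite rev_ordK.
have on : odd n by have := ltn_ord i; rewrite /= in ri; lia.
have [w w0 cw] := LambdaG_center LG on.
have := v_col 0%N; rewrite cw => /matrixP/(_ 0 0); rewrite !mxE (bigD1 i) //=.
have rii : rev_ord i = i by apply/val_inj/esym/ri.
rewrite mxE rii eqxx big1 ?addr0 => [|i' i'i].
  by move=> /eqP; rewrite mulf_eq0 (negPf w0) orbF => /eqP.
rewrite mxE; case: eqP => [e|_]; last by rewrite mulr0.
case/eqP: i'i; apply/val_inj; have := congr1 val e.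
by have := ltn_ord i; have := ltn_ord i'; rewrite /= in ri *; lia.
Qed.

(** Each list uses up two columns, so the list of index [j] begins at column [2 * j] of [f]. *)
Lemma jordan_chains_flatten (F : fieldType) n (A : 'M[F]_n) f
    (B : nat -> seq (F * nat)) s p :
  (forall j, \sum_(b <- B j) b.2 = 2)%N ->
  (forall j, (s <= j < s + p)%N ->
     jordan_chains A (fun k => f (2 * j + k)%N) (B j)) ->
  jordan_chains A (fun k => f (2 * s + k)%N) (flatten [seq B j | j <- iota s p]).
Proof.
move=> B2; elim: p s => [//|p IHp] s Bf /=; apply: jordan_chains_cat.
  by apply: Bf; lia.
apply: (@jordan_chains_ext _ _ _ (fun k => f (2 * s.+1 + k)%N)).
  by move=> k; rewrite B2 mulnS addnCA !addnA [(2 + _)%N]addnC.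
by apply: IHp => j js; apply: Bf; lia.
Qed.

(** The blocks in the order of the columns of Lambda_G: first the center, then the pairs from the
    middle outwards. *)
Definition modal_blocks (F : fieldType) n (sq : F -> F) (a : nat -> F) (c : F) :
    seq (F * nat) :=
  nseq (odd n) (c, 1%N) ++
  flatten [seq pair_blocks sq (a (odd_index n j.+1)) (a (even_index j.+1))
          | j <- iota 0 n./2].

Lemma pair_blocks_size (F : fieldType) (sq : F -> F) x y :
  (\sum_(b <- pair_blocks sq x y) b.2 = 2)%N.
Proof. by rewrite /pair_blocks; case: ifP; rewrite unlock. Qed.

Lemma jordan_dim_sum (F : fieldType) (bs : seq (F * nat)) :
  jordan_dim bs = (\sum_(b <- bs) b.2)%N.
Proof. by rewrite (big_nth (0, 0%N)) big_mkord. Qed.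

Lemma modal_blocks_dim (F : fieldType) n (sq : F -> F) a c :
  jordan_dim (modal_blocks n sq a c) = n.
Proof.
rewrite jordan_dim_sum big_cat /= big_flatten /= big_map.
rewrite [X in (_ + X)%N](eq_bigr (fun=> 2%N)) => [|j _]; last first.
  exact: pair_blocks_size.
rewrite big_const_seq count_predT size_iota iter_addn_0.
have -> : (\sum_(b <- nseq (odd n) (c, 1)) b.2 = odd n)%N.
  by case: (odd n); rewrite unlock.
by rewrite -[RHS]odd_double_half -mul2n.
Qed.

Lemma standard_form_pair (F : fieldType) n (A : 'M[F]_n) a (u : 'I_n) :
  standard_form A a -> (u < rev_ord u)%N ->
  a (odd_index n (n./2 - u)) = A u (rev_ord u) /\
  a (even_index (n./2 - u)) = A (rev_ord u) u.
Proof.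
move=> [_ +] u_rev => /(_ (n./2 - u)%N u (rev_ord u))[|-> ->] //.
exact/pair_rowsP.
Qed.

Lemma modal_blocks_chains (F : numFieldType) n (sq : F -> F) a c (A L : 'M[F]_n) :
  (forall z, sq z ^+ 2 = z) -> antidiagonal A ->
  (forall i : 'I_n, rev_ord i = i -> A i i = c) ->
  standard_form A a -> is_LambdaG sq a L ->
  jordan_chains A (nat_col L) (modal_blocks n sq a c).
Proof.
move=> hsq hA hc sA LG; apply: jordan_chains_cat.
  case: (boolP (odd n)) => //= on; split=> // -[|//] _.
  have [w w0 ->] := LambdaG_center LG on; rewrite addr0.
  apply/colP => i; rewrite antidiagonal_mul // !mxE rev_ordK eq_sym.
  by case: eqP => [e|_]; rewrite ?mulr0 // -e hc // -{1}e.
have -> : (\sum_(b <- nseq (odd n) (c, 1)) b.2 = odd n)%N.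
  by case: (odd n); rewrite unlock.
apply: (@jordan_chains_flatten _ _ _ (fun k => nat_col L (odd n + k))) => [j|j j_m].
  exact: pair_blocks_size.
(* The pair numbers start at 1 and [j] at 0, so the upper row, counted from 0, is [n./2 - j.+1]. *)
have u_n : (n./2 - j.+1 < n)%N by lia.
pose u := Ordinal u_n.
have u_rev : (u < rev_ord u)%N by rewrite /=; lia.
have jE : (n./2 - u)%N = j.+1 by rewrite /=; lia.
have [x1 [y1 [x2 [y2 []]]]] := LambdaG_pair LG u_rev.
have [] := standard_form_pair sA u_rev; rewrite jE => -> -> /= c1 c2 mp.
apply: (pair_chains hsq hA u_rev mp); first by rewrite addn0.
by rewrite -c2 addn1 addnS.
Qed.

Lemma modal_blocks_modal (F : numFieldType) n (sq : F -> F) a c (A L : 'M[F]_n) :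
  (forall z, sq z ^+ 2 = z) -> antidiagonal A ->
  (forall i : 'I_n, rev_ord i = i -> A i i = c) ->
  standard_form A a -> is_LambdaG sq a L ->
  generalized_modal A L (modal_blocks n sq a c).
Proof.
move=> hsq hA hc sA LG; split.
- rewrite all_cat all_nseq orbT; apply/allP => b /flattenP[_ /mapP[j _ ->]].
  rewrite /pair_blocks; case: ifP => _; rewrite !inE; first by move/eqP->.
  by case/orP => /eqP->.
- exact: LambdaG_unitmx LG.
exists (modal_blocks_dim n sq a c).
apply: jordan_chains_modal (modal_blocks_chains hsq hA hc sA LG) _ => k.
exact: nat_col_ord.
Qed.

Lemma generalized_modal_similar (F : fieldType) n (A M : 'M[F]_n) bs :
  generalized_modal A M bs -> similar_mx A (jordan_mx bs).
Proof.
(* Similarity is witnessed by a [P] with [P *m A = B *m P], hence by the inverse of the modal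
   matrix. *)
move=> [_ Mu [e AM]]; exists e; exists (invmx M); rewrite ?unitmx_inv //.
apply/simmxP; rewrite ?unitmx_inv //.
by apply: (can_inj (mulKmx Mu)); rewrite mulKVmx // mulmxA -AM mulmxK.
Qed.

(** * Existence of the standard form and of the modal matrix *)

(* The row in which the standard form puts the entry a_p. *)
Definition antidiag_row n (p : nat) : nat :=
  (if odd p then n./2 - (if odd n then p./2 else uphalf p)
   else n./2 + p./2 - ~~ odd n)%N.

Definition antidiag_entry (F : fieldType) n (A : 'M[F]_n) (p : nat) : F :=
  if insub (antidiag_row n p) is Some i then A i (rev_ord i) else 0.

Lemma antidiag_entryE (F : fieldType) n (A : 'M[F]_n) p (i : 'I_n) :
  antidiag_row n p = i -> antidiag_entry A p = A i (rev_ord i).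
Proof. by rewrite /antidiag_entry => ->; rewrite valK. Qed.

(** A standard form only names the antidiagonal entries, so every matrix has one; it supplies the
    [a] for which a modal matrix is built. *)
Lemma antidiag_entry_standard (F : fieldType) n (A : 'M[F]_n) :
  standard_form A (antidiag_entry A).
Proof.
split=> [i on im|j u l /pair_rowsP[u_rev -> ->]].
  have {2}-> : i = rev_ord i by apply/val_inj => /=; lia.
  by apply/esym/antidiag_entryE; rewrite /antidiag_row on /=; lia.
rewrite /= in u_rev; split; last rewrite -{2}[u]rev_ordK.
  apply/esym/antidiag_entryE; rewrite /antidiag_row /odd_index.
  by case: (boolP (odd n)) => on; case: ifP => ?; lia.
apply/esym/antidiag_entryE; rewrite /antidiag_row /even_index /=.
by case: ifP => ?; have := ltn_ord u; lia.
Qed.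

(** One admissible choice: [x = 1] and [y = 0] for a defective pair, the standard basis for a pair
    of zeros. *)
Definition modal_vecs (F : fieldType) (sq : F -> F) (ao ae : F) :
    (F * F) * (F * F) :=
  match ao == 0, ae == 0 with
  | false, false => ((- (sq ao / sq ae), 1), (sq ao / sq ae, 1))
  | true, true => ((1, 0), (0, 1))
  | false, true => ((1, 0), (0, 1 / ao))
  | true, false => ((0, 1), (1 / ae, 0))
  end.

Lemma modal_vecsP (F : fieldType) (sq : F -> F) ao ae :
  let v := modal_vecs sq ao ae in
  modal_pair sq ao ae (vec2 v.1.1 v.1.2) (vec2 v.2.1 v.2.2).
Proof.
rewrite /modal_vecs /modal_pair; case: eqP => _; case: eqP => _ //=.
- rewrite free_cons span_seq1 seq1_free; apply/andP; split.
    apply/vlineP => -[k /colP/(_ 0)/eqP]; rewrite !mxE /= mulr0.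
    exact/negP/oner_neq0.
  apply/eqP => /colP/(_ 1)/eqP; rewrite !mxE /=; exact/negP/oner_neq0.
- by exists 1, 0; rewrite oner_neq0.
- by exists 1, 0; rewrite oner_neq0.
Qed.

(** The center entry omega is 1. Column [k], counted from 0, belongs to pair [j] and is the second
    of its two columns exactly when [n] and [k] differ in parity. *)
Definition LambdaG (F : fieldType) n (sq : F -> F) (a : nat -> F) : 'M[F]_n :=
  \matrix_(i, k)
    if odd n && (k == 0%N :> nat) then (i.+1 == n./2.+1)%:R else
    let j := if odd n then uphalf k else k./2.+1 in
    let v := modal_vecs sq (a (odd_index n j)) (a (even_index j)) in
    let w := if odd n (+) odd k then v.2 else v.1 in
    if i.+1 == (n./2.+1 - j)%N then w.1
    else if i.+1 == (if odd n then n./2.+1 + j else n./2 + j)%N then w.2 else 0.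

Lemma LambdaGP (F : fieldType) n (sq : F -> F) (a : nat -> F) :
  is_LambdaG sq a (LambdaG n sq a).
Proof.
split=> [on|j u l k1 k2 [j_m uE lE] k1E k2E].
  exists 1; first exact: oner_neq0.
  by move=> i k [k0]; rewrite mxE on k0 /=; case: eqP.
have k1n : odd n && (k1 == 0%N :> nat) = false by case: ifP k1E => ?; lia.
have k2n : odd n && (k2 == 0%N :> nat) = false by case: ifP k1E => ?; lia.
have j1 : (if odd n then uphalf k1 else k1./2.+1) = j by case: ifP k1E => ?; lia.
have j2 : (if odd n then uphalf k2 else k2./2.+1) = j by case: ifP k1E => ?; lia.
have o1 : odd n (+) odd k1 = false by case: ifP k1E => ?; lia.
have o2 : odd n (+) odd k2 = true by case: ifP k1E => ?; lia.
have lu : (l.+1 == (n./2.+1 - j)%N) = false by case: ifP lE => ?; lia.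
split=> [i iu il|].
  rewrite !mxE k1n k2n j1 j2; cbv zeta.
  rewrite -uE -lE !eqSS.
  by rewrite (negPf (iu : i != u :> nat)) (negPf (il : i != l :> nat)).
rewrite !mxE k1n k2n j1 j2 o1 o2; cbv zeta; rewrite lu -uE -lE !eqxx.
exact: modal_vecsP.
Qed.

(** * Counting blocks *)

Lemma count_flatten_sum (T U : eqType) (x : U) (B : T -> seq U) (s : seq T) :
  count_mem x (flatten [seq B t | t <- s]) = (\sum_(t <- s) count_mem x (B t))%N.
Proof. by rewrite count_flatten sumnE !big_map. Qed.

(** The rows above their reflection are those below [n./2] in number; reversing this range matches
    pair numbers with upper rows. *)
Lemma upper_half_sum n (H : nat -> nat) :
  (\sum_(j <- iota 0 n./2) H j.+1 =
   \sum_(u : 'I_n | (u < rev_ord u)%N) H (n./2 - u))%N.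
Proof.
rewrite (eq_bigl (fun u : 'I_n => (u < n./2)%N)) => [|u]; last first.
  by have := ltn_ord u; rewrite /=; lia.
have mn : (n./2 <= n)%N by lia.
rewrite -(big_mkord (fun u => u < n./2)%N (fun u => H (n./2 - u)%N)).
rewrite (big_cat_nat (leq0n _) mn) //=.
rewrite [X in (_ + X)%N]big_nat_cond [X in (_ + X)%N]big_pred0.
  have -> : iota 0 n./2 = index_iota 0 n./2 by rewrite /index_iota subn0.
  rewrite addn0 big_nat_rev [LHS]big_nat_cond [RHS]big_nat_cond.
  by apply: eq_big => [j|j j_m]; [lia | congr H; lia].
by move=> u; lia.
Qed.

Lemma count_sum (T : Type) (p : pred T) (s : seq T) :
  count p s = (\sum_(t <- s) p t)%N.
Proof. by rewrite -sum1_count big_mkcond; apply: eq_bigr => t _; case: (p t). Qed.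

Lemma defective_center (F : fieldType) n (A : 'M[F]_n) i :
  rev_ord i = i -> defective A i = false.
Proof. by move=> ri; rewrite /defective ri addbb. Qed.

(** The multiplicities of every block agree: over the noncentral upper rows, a defective pair
    contributes one nilpotent block and a nondefective one the blocks of [lam t] and [- lam t]. *)
Lemma modal_blocks_perm (F : fieldType) n (A : 'M[F]_n) (sq : F -> F) a c
    (lam : 'I_n -> F) (ts : seq 'I_n) :
  standard_form A a ->
  (forall t : 'I_n, t \in nondefective_pairs A ->
     lam t = sq (A t (rev_ord t)) * sq (A (rev_ord t) t) \/
     lam t = - (sq (A t (rev_ord t)) * sq (A (rev_ord t) t))) ->
  perm_eq ts (enum (nondefective_pairs A :\: center_pairs n)) ->
  perm_eq (modal_blocks n sq a c)
    (quasidiagonal_blocks #|defective_pairs A|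
       ([seq lam t | t <- ts] ++ nseq (odd n) c ++ [seq - lam t | t <- rev ts])).
Proof.
move=> sA hlam hts; apply/allP => x _; apply/eqP.
pose B u := pair_blocks sq (A u (rev_ord u)) (A (rev_ord u) u).
have lt_rev (u : 'I_n) : (u < rev_ord u)%N =
    (u \in transpose_pairs n) && (u \notin center_pairs n).
  by rewrite !inE ltn_neqAle andbC eq_sym.
transitivity (count_mem x (nseq (odd n) (c, 1%N)) +
    \sum_(u : 'I_n | (u < rev_ord u)%N) count_mem x (B u))%N.
  rewrite count_cat count_flatten_sum; congr (_ + _)%N.
  rewrite (upper_half_sum n (fun j => count_mem x
    (pair_blocks sq (a (odd_index n j)) (a (even_index j))))).
  by apply: eq_bigr => u /(standard_form_pair sA)[-> ->].
rewrite (bigID (defective A)) /= count_cat !map_cat !count_cat !map_nseq !count_nseq.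
rewrite !count_map !count_sum (perm_big _ (permEl (perm_rev ts))) /=.
have -> : (\sum_(u : 'I_n | (u < rev_ord u) && defective A u) count_mem x (B u) =
    (pred1 x (0%R, 2)) * #|defective_pairs A|)%N.
  rewrite -sum1_card big_distrr /=; apply: eq_big => u.
    (* The center is never defective, so excluding it leaves the set of defective pairs
       unchanged. *)
    rewrite lt_rev !inE; case: (eqVneq (rev_ord u) u) => [/defective_center ->|].
      by rewrite !andbF.
    by rewrite andbT.
  by case/andP=> _ du; rewrite /B /pair_blocks [_ (+) _]du /= addn0 muln1.
have -> : (\sum_(u : 'I_n | (u < rev_ord u) && ~~ defective A u) count_mem x (B u) =
    \sum_(t <- ts) ((pred1 x (lam t, 1)) + (pred1 x ((- lam t)%R, 1))))%N.
  rewrite (perm_big _ hts) big_enum /=; apply: eq_big => u.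
    by rewrite lt_rev !inE -andbA andbCA.
  case/andP=> u_rev ndu.
  have u_nd : u \in nondefective_pairs A by rewrite !inE ndu ltnW.
  rewrite /B /pair_blocks -[_ (+) _]/(defective A u) (negPf ndu) /= addn0.
  (* The choice of sign of [lam u] only swaps the two blocks. *)
  by case: (hlam u u_nd) => ->; rewrite ?opprK // addnC.
rewrite big_split /=; lia.
Qed.

(** Both sides have the same Jordan blocks: the symmetric diagonal is regrouped into pairs [f t],
    [- f t] with [c] moved to the end. *)
Lemma quasidiagonal_block_similar (F : fieldType) (T : eqType) d (f : T -> F)
    (ts : seq T) (b : bool) (c : F) :
  similar_mx
    (jordan_mx (quasidiagonal_blocks d
       ([seq f t | t <- ts] ++ nseq b c ++ [seq - f t | t <- rev ts])))
    (block_mx (\mxdiag_(k < d) nilp2 F) 0 0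
       (block_mx (\mxdiag_(k < size ts) ([seq f t | t <- ts]`_k *: sgn2 F)) 0 0
          (c *: (1%:M : 'M[F]_b)))).
Proof.
apply: similar_sym; apply: similar_trans (similar_block (similar_nilp2_sum _ _)
  (similar_block (similar_sgn2_sum _ _) (similar_scalar_bool _ _))) _.
apply: similar_trans (similar_block (similar_refl _)
  (similar_sym (jordan_mx_cat _ _))) _.
apply: similar_trans (similar_sym (jordan_mx_cat _ _)) _.
apply: jordan_mx_perm; rewrite perm_cat2l; apply/allP => x _; apply/eqP.
rewrite !map_cat !count_cat map_nseq count_flatten_sum !count_map !count_sum.
rewrite (perm_big _ (permEl (perm_rev ts))) /= addnCA addnC; congr (_ + _)%N.
by rewrite -big_split; apply: eq_bigr => t _; rewrite /= addn0.
Qed.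

(** * Jordan form, canonical basis and nilpotent-diagonal splitting of [A] *)

Unset Implicit Arguments.

Theorem theorem5p8 (R : realType) (n : nat) (A : 'M[R[i]]_n) (c : R[i])
    (sq : R[i] -> R[i]) (lam : 'I_n -> R[i]) (ts : seq 'I_n)
    (hA : antidiagonal A)
    (hc : forall i : 'I_n, rev_ord i = i -> A i i = c)
    (hsq : forall z : R[i], sq z ^+ 2 = z)
    (hlam : forall t : 'I_n, t \in nondefective_pairs A ->
       lam t = sq (A t (rev_ord t)) * sq (A (rev_ord t) t) \/
       lam t = - (sq (A t (rev_ord t)) * sq (A (rev_ord t) t)))
    (hts : perm_eq ts (enum (nondefective_pairs A :\: center_pairs n))) :
  let J : seq (R[i] * nat) :=
    quasidiagonal_blocks #|defective_pairs A|
      ([seq lam t | t <- ts] ++ nseq (odd n) c ++ [seq - lam t | t <- rev ts]) in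
  let N := \mxdiag_(k < #|defective_pairs A|) nilp2 R[i] in
  let D := \mxdiag_(k < size ts) ([seq lam t | t <- ts]`_k *: sgn2 R[i]) in
  [/\ (forall bs : seq (R[i] * nat), jordan_form A bs <-> perm_eq bs J),
      (forall (a : nat -> R[i]) (L : 'M[R[i]]_n),
         standard_form A a -> is_LambdaG sq a L ->
         exists2 bs : seq (R[i] * nat),
           perm_eq bs J & generalized_modal A L bs) &
      similar_mx A
        (block_mx N 0 0 (block_mx D 0 0 (c *: (1%:M : 'M[R[i]]_(odd n)))))].
Proof.
move=> J N D.
have modal a L : standard_form A a -> is_LambdaG sq a L ->
    exists2 bs, perm_eq bs J & generalized_modal A L bs.
  move=> sA LG; exists (modal_blocks n sq a c).
    exact: modal_blocks_perm sA hlam hts.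
  exact: modal_blocks_modal hsq hA hc sA LG.
(* Existence of the Jordan form follows from the second claim applied to one explicit standard form
   and modal matrix. *)
have [bs0 bs0J modal0] :=
  modal _ _ (antidiag_entry_standard A) (LambdaGP n sq (antidiag_entry A)).
have AJ : similar_mx A (jordan_mx J).
  exact: similar_trans (generalized_modal_similar modal0) (jordan_mx_perm bs0J).
have J_gt0 : all (fun b : R[i] * nat => 0 < b.2)%N J.
  by rewrite -(perm_all _ bs0J); case: modal0.
split=> //; last exact: similar_trans AJ (quasidiagonal_block_similar _ _ _ _ _).
move=> bs; split=> [[bs_gt0 Abs]|bsJ].
  by apply: jordan_mx_uniq => //; apply: similar_trans (similar_sym Abs) AJ.
split; first by rewrite (perm_all _ bsJ).
by apply: similar_trans AJ _; apply: jordan_mx_perm; rewrite perm_sym.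
Qed.
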